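(* Let $X$ be a real reflexive Banach space with dual $Y$, let $\phi\in\Gamma_0(X)$, let $\varepsilon>0$, and let $\bar{B}_Y(\varepsilon) = \{a\in Y : \|a\|\leq\varepsilon\}$. Let $$M(\phi,\varepsilon) = \{ (x,y) \in X \times Y : \text{there is } a \in Y \text{ with } \|a\| \leq \varepsilon \text{ and } y + a \in \partial \phi(x) \}$$ and let $b_A : X\times Y\to\mathbb{R}\cup\{+\infty\}$ be defined by $$b_A(x,y) = \inf\left\{\phi(x)+\phi^{*}(y-a)+\langle x,a\rangle : a\in Y,\ \|a\|\leq\varepsilon\right\}.$$ Then $b_A$ is a bipotential such that $M(b_A) = M(\phi,\varepsilon)$ if and only if for every $y\in Y$ the function $f(\cdot,\cdot,y) : \bar{B}_Y(\varepsilon)\times X\to\mathbb{R}\cup\{+\infty\}$ defined by $$f(a,x,y) = \phi(x)+\phi^{*}(y-a)+\langle x,a\rangle$$ is implicitly convex.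
   Context: $X$ is a real reflexive Banach space, $Y = X^*$ its dual, $\langle x,y\rangle = y(x)$, and $\|\cdot\|$ denotes both the norm of $X$ and the dual norm of $Y$. By reflexivity, the dual of $Y$ is identified with $X$. Conventions: $\bar{\mathbb{R}} = \mathbb{R}\cup\{+\infty\}$; $a + (+\infty) = +\infty$ for $a\in\bar{\mathbb{R}}$, and $a\cdot(+\infty) = +\infty$ for all $a \geq 0$. For $\psi: X \to \bar{\mathbb{R}}$, $\mathrm{dom}\,\psi = \{x : \psi(x) \in \mathbb{R}\}$. $\Gamma_0(X)$ is the set of convex lower semicontinuous functions $\psi : X \to \bar{\mathbb{R}}$ with $\mathrm{dom}\,\psi \neq \emptyset$; $\Gamma_0(Y)$ is defined similarly. The subdifferential is $\partial\psi(x) = \{u \in Y : \langle z - x, u\rangle \leq \psi(z) - \psi(x)\ \forall z \in X\}$, understood to be empty if $\psi(x) = +\infty$; for functions on $Y$ the subdifferential is a subset of $X$, defined analogously. The Fenchel conjugate of $\phi$ is $\phi^*(y) = \sup_{x\in X}(\langle x,y\rangle - \phi(x))$. Implicit convexity: let $\Lambda$ be a non-empty set and $V$ a real vector space. A function $g : \Lambda\times V\to\bar{\mathbb{R}}$ is implicitly convex if for any $(\lambda_1,z_1),(\lambda_2,z_2)\in\Lambda\times V$ and any $\alpha,\beta\in[0,1]$ with $\alpha+\beta=1$ there exists $\lambda\in\Lambda$ such that $g(\lambda,\alpha z_1+\beta z_2)\leq\alpha g(\lambda_1,z_1)+\beta g(\lambda_2,z_2)$. Here it is applied with $\Lambda=\bar{B}_Y(\varepsilon)$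 and $V=X$. A bipotential is a function $b : X\times Y \to \bar{\mathbb{R}}$ such that: (a) for any $x\in X$, if $\mathrm{dom}\, b(x,\cdot) \neq \emptyset$ then $b(x,\cdot)\in\Gamma_0(Y)$; for any $y \in Y$, if $\mathrm{dom}\, b(\cdot,y)\neq\emptyset$ then $b(\cdot,y)\in\Gamma_0(X)$; (b) $b(x,y)\geq\langle x,y\rangle$ for all $(x,y) \in X\times Y$; (c) for all $(x,y)\in X\times Y$: $y\in\partial b(\cdot,y)(x) \iff x\in\partial b(x,\cdot)(y) \iff b(x,y)=\langle x,y\rangle$. The graph of $b$ is $M(b) = \{(x,y)\in X\times Y : b(x,y)=\langle x,y\rangle\}$. *)

(* Defs.v *)
From HB Require Import structures.
From mathcomp Require Import all_boot all_order all_algebra.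
From mathcomp Require Import all_classical all_reals all_analysis.
Set Implicit Arguments.
Unset Strict Implicit.
Unset Printing Implicit Defensive.

Import Order.TTheory GRing.Theory Num.Theory.
Import numFieldNormedType.Exports.

Local Open Scope classical_set_scope.
Local Open Scope ring_scope.

Section dual_space.
Context {R : realType} (X : normedModType R).

Definition dual_pred : {pred X -> R^o} :=
  [pred f | `[< linear f /\ continuous f >]].

Lemma dual_predP (f : X -> R^o) :
  reflect (linear f /\ continuous f) (f \in dual_pred).
Proof. exact: asboolP. Qed.

Lemma dual_pred_submod : submod_closed dual_pred.
Proof.
split=> [|k f g].
  apply/dual_predP; split; last exact: cst_continuous.
  by by move=> a u v; rewrite -[RHS]/(a *: (0 : R^o) + 0) scaler0 addr0.
move=> /dual_predP[lf cf] /dual_predP[lg cg]; apply/dual_predP; split.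
  move=> a u v; rewrite -[LHS]/(k *: f (a *: u + v) + g (a *: u + v)).
  rewrite -[RHS]/(a *: (k *: f u + g u) + (k *: f v + g v)).
  rewrite lf lg !scalerDr !scalerA [k * a]mulrC.
  by rewrite -!addrA; congr (_ + _); rewrite addrCA.
move=> x; apply: cvgD; last exact: cg.
by apply: cvgZ; [exact: cvg_cst|exact: cf].
Qed.

HB.instance Definition _ :=
  GRing.isSubmodClosed.Build R (X -> R^o) dual_pred dual_pred_submod.

Record dual := Dual { dual_fun :> X -> R^o ; _ : dual_fun \in dual_pred }.

HB.instance Definition _ := [isSub for dual_fun].
HB.instance Definition _ := [Choice of dual by <:].
HB.instance Definition _ := [SubChoice_isSubLmodule of dual by <:].

Lemma dual_linear (f : dual) : linear f.
Proof. by case: f => f /= /dual_predP[]. Qed.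

Lemma dual_continuous (f : dual) : continuous f.
Proof. by case: f => f /= /dual_predP[]. Qed.

HB.instance Definition _ (f : dual) :=
  GRing.isLinear.Build R X R^o _ (dual_fun f) (dual_linear f).

Definition dual_norm (f : dual) : R :=
  sup [set `|f x| | x in [set x : X | `|x| <= 1]].

Lemma dual_norm_has_sup (f : dual) :
  has_sup [set `|f x| | x in [set x : X | `|x| <= 1]].
Proof.
split; first by exists `|f 0|, 0 => //=; rewrite normr0.
have /linear_bounded_continuous/bounded_funP/(_ 1)[M fM] :=
  @dual_continuous f.
by exists M => _ [x x1 <-]; exact: fM.
Qed.

Lemma dual_norm_ub (f : dual) (x : X) : `|x| <= 1 -> `|f x| <= dual_norm f.
Proof.
by move=> x1; apply: (sup_upper_bound (dual_norm_has_sup f)); exists x.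
Qed.

Lemma dual_norm_le (f : dual) (M : R) :
  (forall x : X, `|x| <= 1 -> `|f x| <= M) -> dual_norm f <= M.
Proof.
move=> fM; apply: ge_sup; first by case: (dual_norm_has_sup f).
by move=> _ [x x1 <-]; exact: fM.
Qed.

Lemma dual_addE (f g : dual) (x : X) : (f + g) x = f x + g x.
Proof. by []. Qed.

Lemma dual_scaleE (k : R) (f : dual) (x : X) : (k *: f) x = k * f x.
Proof. by []. Qed.

Lemma dual_ler_normD (f g : dual) :
  dual_norm (f + g) <= dual_norm f + dual_norm g.
Proof.
apply: dual_norm_le => x x1; rewrite dual_addE (le_trans (ler_normD _ _))//.
by rewrite lerD// dual_norm_ub.
Qed.

Let dual_normZ_le (k : R) (f : dual) :
  dual_norm (k *: f) <= `|k| * dual_norm f.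
Proof.
apply: dual_norm_le => x x1; rewrite dual_scaleE normrM.
by rewrite ler_wpM2l// dual_norm_ub.
Qed.

Lemma dual_norm_ge0 (f : dual) : 0 <= dual_norm f.
Proof. by apply: le_trans (@dual_norm_ub f 0 _); rewrite ?normr0. Qed.

Lemma dual_normrZ (k : R) (f : dual) :
  dual_norm (k *: f) = `|k| * dual_norm f.
Proof.
apply/eqP; rewrite eq_le dual_normZ_le/=.
have [->|k0] := eqVneq k 0; first by rewrite normr0 mul0r dual_norm_ge0.
rewrite -ler_pdivlMl ?normr_gt0// -normfV.
by rewrite (le_trans _ (dual_normZ_le _ _))// scalerA mulVf// scale1r.
Qed.

Lemma dual_norm_apply (f : dual) (x : X) : `|f x| <= dual_norm f * `|x|.
Proof.
have [->|x0] := eqVneq x 0; first by rewrite linear0 !normr0 mulr0.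
rewrite -ler_pdivrMr ?normr_gt0//.
have -> : `|f x| / `|x| = `|f (`|x|^-1 *: x)|.
  by rewrite linearZ/= normrM normfV normr_id mulrC.
by apply: dual_norm_ub; rewrite normrZ normfV normr_id mulVf// normr_eq0.
Qed.

Lemma dual_normr0_eq0 (f : dual) : dual_norm f = 0 -> f = 0.
Proof.
move=> f0; apply/val_inj/funext => x /=.
apply/eqP; rewrite -normr_le0.
by rewrite (le_trans (dual_norm_apply f x))// f0 mul0r.
Qed.

HB.instance Definition _ := Lmodule_isNormed.Build R dual
  dual_ler_normD dual_normrZ dual_normr0_eq0.

Lemma dual_normE (f : dual) :
  `|f| = sup [set `|f x| | x in [set x : X | `|x| <= 1]].
Proof. by []. Qed.

End dual_space.
Arguments dual_pred {R} X.

Section reflexivity.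
Context {R : realType} (X : normedModType R).

Lemma bidual_subproof (x : X) :
  (fun f : dual X => f x : R^o) \in dual_pred (dual X).
Proof.
apply/dual_predP.
pose ev (f : dual X) : R^o := f x.
have lev : linear ev by [].
split=> //.
pose L := GRing.isLinear.Build R (dual X) R^o _ ev lev.
pose evL : {linear dual X -> R^o} := HB.pack ev L.
apply: (@linear_bounded_continuous R (dual X) R^o evL).1.
apply/bounded_funP => r; exists (r * `|x|) => f fr.
by rewrite (le_trans (dual_norm_apply f x))// ler_wpM2r.
Qed.

(* The canonical embedding of X into its bidual. *)
Definition bidual (x : X) : dual (dual X) := Dual (bidual_subproof x).

Definition reflexive_space : Prop := forall F : dual (dual X), range bidual F.

End reflexivity.

Section convex_analysis.
Context {R : realType}.
Local Open Scope ereal_scope.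

(* a.x for a real a >= 0 and x in R u {+oo}, with the convention
   0.(+oo) = +oo, whereas 0 * +oo = 0 in the library. *)
Definition wscale (a : R) (x : \bar R) : \bar R :=
  if x == +oo then +oo else a%:E * x.

Definition edom {T : Type} (g : T -> \bar R) : set T :=
  [set t | g t \is a fin_num].

Definition econvex {V : lmodType R} (g : V -> \bar R) : Prop :=
  forall (v w : V) (a b : R), (0 <= a)%R -> (0 <= b)%R -> (a + b = 1)%R ->
    g (a *: v + b *: w)%R <= wscale a (g v) + wscale b (g w).

(* Functions with values in R u {+oo} are represented as functions to \bar R
   that do not take the value -oo. *)
Definition Gamma0 (V : normedModType R) : set (V -> \bar R) :=
  [set g | [/\ forall v, g v != -oo, econvex g, lower_semicontinuous g &
               edom g !=set0]].

Definition subdiff {V : normedModType R} (g : V -> \bar R) (v : V) :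
    set (dual V) :=
  [set u | edom g v /\ forall w : V, (u (w - v)%R)%:E <= g w - g v].

Definition conjugate {V : normedModType R} (g : V -> \bar R) (u : dual V) :
    \bar R :=
  ereal_sup [set (u v)%:E - g v | v in [set: V]].

(* The first variable ranges over the subset L of the type T. *)
Definition implicitly_convex {T : Type} {V : lmodType R} (L : set T)
    (g : T -> V -> \bar R) : Prop :=
  (forall l v, L l -> g l v != -oo) /\
  forall (l1 l2 : T) (v1 v2 : V) (a b : R), L l1 -> L l2 ->
    (0 <= a <= 1)%R -> (0 <= b <= 1)%R -> (a + b = 1)%R ->
    exists2 l, L l &
      g l (a *: v1 + b *: v2)%R <= wscale a (g l1 v1) + wscale b (g l2 v2).

End convex_analysis.
Arguments Gamma0 {R} V.

Section bipotentials.
Context {R : realType} {X : normedModType R}.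
Local Notation Y := (dual X).
Local Open Scope ereal_scope.

Definition bgraph (b : X -> Y -> \bar R) : set (X * Y) :=
  [set p | b p.1 p.2 = (p.2 p.1)%:E].

(* The subdifferential of b x : Y -> \bar R is a subset of dual Y; a point x
   of X belongs to it through the canonical embedding bidual. *)
Definition bipotential (b : X -> Y -> \bar R) : Prop :=
  [/\ forall x y, b x y != -oo,
      (forall x, edom (b x) !=set0 -> Gamma0 Y (b x)) /\
      (forall y, edom (fun x => b x y) !=set0 -> Gamma0 X (fun x => b x y)),
      forall (x : X) (y : Y), (y x)%:E <= b x y &
      forall (x : X) (y : Y),
        (subdiff (fun x => b x y) x y <-> subdiff (b x) y (bidual x)) /\
        (subdiff (b x) y (bidual x) <-> b x y = (y x)%:E)].

Definition dual_cball (eps : R) : set Y := [set a | (`|a| <= eps)%R].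

Definition Mset (phi : X -> \bar R) (eps : R) : set (X * Y) :=
  [set p | exists2 a, dual_cball eps a & subdiff phi p.1 (p.2 + a)%R].

Definition fA (phi : X -> \bar R) (a : Y) (x : X) (y : Y) : \bar R :=
  phi x + conjugate phi (y - a)%R + (a x)%:E.

Definition bA (phi : X -> \bar R) (eps : R) (x : X) (y : Y) : \bar R :=
  ereal_inf [set fA phi a x y | a in dual_cball eps].

End bipotentials.

(* Main.v *)
From HB Require Import structures.
Require Import Defs.
From mathcomp Require Import all_boot all_order all_algebra.
From mathcomp Require Import all_classical all_reals all_analysis.
From mathcomp Require Import ring lra.
Import numFieldNormedType.Exports.
Local Open Scope classical_set_scope.
Local Open Scope ring_scope.

Set Implicit Arguments.
Unset Strict Implicit.
Unset Printing Implicit Defensive.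
Import Order.TTheory GRing.Theory Num.Theory.

(** For fixed [y], [bA phi eps x y] is the infimum over [a] in the dual ball of
    [fA phi a x y]. Three facts drive the proof.

    - The infimum is attained. The conjugate of [phi] is a supremum of
      functions that are weak-* continuous, and the dual ball is weak-*
      compact, so [a |-> fA phi a x y] has a minimizer ([bA_attained]). Hence
      implicit convexity of [fA] in [(a, x)] says the same as convexity of
      [x |-> bA phi eps x y] ([econvex_bA_l]): a minimizer at
      [a *: v + b *: w] is the required witness, and conversely the
      inequality between the two given values of [fA] is used at minimizers
      for [v] and [w].

    - The other clauses of the definition of a bipotential, and the description
      of the graph, hold for every [phi] in Gamma0. The Fenchel-Young
      inequality gives [bA >= <x, y>] and, with a minimizer, that equality
      means [y - a] is a subgradient of [phi] at [x] for some [a] in the ball,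
      which is symmetric ([bgraph_bA]). In [y], and up to
      the constant [phi x], [bA] is the infimal convolution of a convex function
      with one supported on a weak-* compact convex set, hence convex and lower semicontinuous ([econvex_bA_r],
      [bA_lsc_r]); in [x], it is [phi] plus an [eps]-Lipschitz function, or
      identically [+oo] ([bA_lsc_l]).

    - Being a subgradient of a partial function of [bA] at a point means that
      [bA - <x, y>] is minimal there along that variable. Along [x] the
      infimum is 0 by definition of the conjugate ([bA_subdiff_l]); along [y]
      it is 0 because [phi] is the supremum of its continuous affine minorants
      ([bA_subdiff_r]).

    The affine minorants come from a Hahn-Banach theorem, obtained here by
    showing that a minimal sublinear functional is linear. *)

(** * Sublinear functionals and the Hahn-Banach theorem *)

Section hahn_banach.
Context {R : realType} {V : lmodType R}.

(** Asking only [p (c *: v) <= c * p v] for [c >= 0] is enough: [c = 0] gives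
    [p 0 = 0], and [c^-1] gives the converse inequality. This form is the one
    that infima satisfy directly. *)
Definition sublinear (p : V -> R) : Prop :=
  (forall v w, p (v + w) <= p v + p w) /\
  (forall c v, 0 <= c -> p (c *: v) <= c * p v).

Lemma sublinear0 (p : V -> R) : sublinear p -> p 0 = 0.
Proof.
move=> [pD pZ]; apply/eqP; rewrite eq_le.
have := pZ 0 0 (lexx _); rewrite scale0r mul0r => -> /=.
by have := pD 0 0; rewrite addr0; lra.
Qed.

Lemma sublinearZ (p : V -> R) c v : sublinear p -> 0 <= c ->
  p (c *: v) = c * p v.
Proof.
move=> sp; rewrite le_eqVlt => /predU1P[<-|c0].
  by rewrite scale0r mul0r sublinear0.
apply/eqP; rewrite eq_le sp.2 ?(ltW c0) //= -ler_pdivlMl //.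
by rewrite -{1}(scalerK (lt0r_neq0 c0) v) sp.2 // invr_ge0 ltW.
Qed.

Lemma sublinear_lower (p : V -> R) v w : sublinear p -> p v - p w <= p (v - w).
Proof.
by move=> [pD _]; rewrite lerBlDr -{1}(subrK w v) pD.
Qed.

(** The three sublinear functionals constructed below (chain infimum, directional
    lowering, convex minorization) are infima of this shape. *)
Lemma inf_sublinear (S : V -> set R) :
  (forall v, has_inf (S v)) ->
  (forall v w a b, S v a -> S w b -> exists2 c, S (v + w) c & c <= a + b) ->
  (forall c v a, 0 <= c -> S v a -> exists2 b, S (c *: v) b & b <= c * a) ->
  sublinear (fun v => inf (S v)).
Proof.
move=> Sinf SD SZ; split=> [v w|c v].
  rewrite -lerBlDr; apply: lb_le_inf; first by case: (Sinf v).
  move=> a Sa; rewrite lerBlDr -lerBlDl; apply: lb_le_inf.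
    by case: (Sinf w).
  move=> b Sb; rewrite lerBlDl; have [c Sc cab] := SD _ _ _ _ Sa Sb.
  by apply: le_trans cab; apply: ge_inf => //; case: (Sinf (v + w)).
rewrite le_eqVlt => /predU1P[<-|c0].
  have [[a Sa] _] := Sinf v; have [b Sb] := SZ 0 v a (lexx _) Sa.
  rewrite !mul0r; apply: le_trans.
  by apply: ge_inf => //; case: (Sinf (0 *: v)).
rewrite -ler_pdivrMl //; apply: lb_le_inf; first by case: (Sinf v).
move=> a Sa; rewrite ler_pdivrMl //.
have [b Sb] := SZ c v a (ltW c0) Sa; apply: le_trans.
by apply: ge_inf => //; case: (Sinf (c *: v)).
Qed.

(** If a sublinear [q] is not additive at [y], lowering it along [y] to
    [v |-> inf_(t >= 0) (q (v + t *: y) - t * q y)] gives a smaller sublinear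
    functional. Minimality forces both to agree, and [t = 1] is then the missing
    inequality [q v + q y <= q (v + y)]. *)
Lemma minimal_sublinear_linear (q : V -> R) : sublinear q ->
  (forall q', sublinear q' -> (forall v, q' v <= q v) -> q' = q) ->
  linear (q : V -> R^o).
Proof.
move=> sq qmin.
have qD x y : q (x + y) = q x + q y.
  apply/eqP; rewrite eq_le sq.1 /= -lerBrDr.
  pose S v := [set a | exists2 t, 0 <= t & a = q (v + t *: y) - t * q y].
  have Slb v : has_lbound (S v).
    exists (- q (- v)) => _ [t t0 ->]; rewrite -(sublinearZ _ sq t0).
    have := sublinear_lower (t *: y) (- v) sq.
    by rewrite opprK [_ + v]addrC; lra.
  have Sinf v : has_inf (S v).
    by split; [exists (q (v + 0 *: y) - 0 * q y); exists 0|exact: Slb].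
  have sS : sublinear (fun v => inf (S v)).
    apply: inf_sublinear => // [v w _ _ [t t0 ->] [s s0 ->]|c v _ c0 [t t0 ->]].
      exists (q ((v + w) + (t + s) *: y) - (t + s) * q y).
        by exists (t + s) => //; rewrite addr_ge0.
      have := sq.1 (v + t *: y) (w + s *: y).
      by rewrite scalerDl addrACA; lra.
    exists (q (c *: v + (c * t) *: y) - (c * t) * q y).
      by exists (c * t) => //; rewrite mulr_ge0.
    by rewrite mulrBr -(sublinearZ _ sq c0) scalerDr scalerA mulrA.
  rewrite -{1}(qmin _ sS) => [|v]; apply: ge_inf => //.
    by exists 1 => //; rewrite scale1r mul1r.
  by exists 0 => //; rewrite scale0r mul0r addr0 subr0.
have qN x : q (- x) = - q x.
  by apply/eqP; rewrite -addr_eq0 addrC -qD subrr (sublinear0 sq).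
move=> c x y; rewrite qD; congr (_ + _).
have [c0|/ltW c0] := leP 0 c; first exact: sublinearZ.
rewrite -[in LHS](opprK c) scaleNr qN sublinearZ ?oppr_ge0 //.
by rewrite mulNr opprK.
Qed.

(** The sublinear functionals below [p] form an inductive order: along a chain
    the values at [v] stay above [- p (- v)], so the pointwise infimum is finite,
    and it is sublinear because any two members of the chain are comparable. *)
Theorem hahn_banach (p : V -> R) : sublinear p ->
  exists2 u : V -> R, linear (u : V -> R^o) & forall v, u v <= p v.
Proof.
move=> sp.
pose minor (q : V -> R) := sublinear q /\ forall v, q v <= p v.
pose T := sig minor.
pose below (s t : T) := `[< forall v, sval t v <= sval s v >].
have [| | | |[q [sq qp]] qmin] := @Zorn T below.
- by move=> t; apply/asboolP.
- move=> r s t /asboolP rs /asboolP st; apply/asboolP => v.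
  exact: le_trans (st v) (rs v).
- move=> [s Ps] [t Pt] /asboolP /= ts /asboolP /= st.
  have e : s = t by apply/funext => v; apply/eqP; rewrite eq_le ts st.
  by subst t; congr exist; exact: Prop_irrelevance.
- move=> A Atot; have [->|/set0P[q0 Aq0]] := eqVneq A set0.
    by exists (exist minor p (conj sp (fun v => lexx (p v)))).
  pose S v := [set sval q v | q in A].
  have Slb v : has_lbound (S v).
    exists (- p (- v)) => _ [[q [sq qp]] _ <-] /=.
    rewrite lerNl (le_trans _ (qp (- v))) //.
    by have := sublinear_lower 0 v sq; rewrite (sublinear0 sq) !sub0r.
  have sS : sublinear (fun v => inf (S v)).
    apply: inf_sublinear => [v|v w|c v].
    - by split=> //; exists (sval q0 v), q0.
    - move=> _ _ [q Aq <-] [q' Aq' <-].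
      have [/asboolP qq'|/asboolP q'q] := Atot _ _ Aq Aq'.
        exists (sval q' (v + w)); first by exists q'.
        by rewrite (le_trans ((svalP q').1.1 _ _)) // lerD2r.
      exists (sval q (v + w)); first by exists q.
      by rewrite (le_trans ((svalP q).1.1 _ _)) // lerD2l.
    - move=> _ c0 [q Aq <-]; exists (sval q (c *: v)); first by exists q.
      exact: (svalP q).1.2.
  have Sp v : inf (S v) <= p v.
    rewrite (le_trans _ ((svalP q0).2 v)) //.
    by apply: ge_inf => //; exists q0.
  exists (exist minor _ (conj sS Sp)) => s As; apply/asboolP => v /=.
  by apply: ge_inf => //; exists s.
exists q => //; apply: minimal_sublinear_linear => // q' sq' q'q.
have q'p v : q' v <= p v by exact: le_trans (qp v).
have /(_ _)/(congr1 sval) := qmin (exist minor q' (conj sq' q'p)).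
by apply; apply/asboolP.
Qed.

End hahn_banach.

(** * Extended-valued convex functions *)

Section epigraph.
Context {R : realType}.
Local Open Scope ereal_scope.

Lemma wscale_fin (a r : R) : wscale a r%:E = (a * r)%:E.
Proof. by []. Qed.

Lemma wscale_pinfty (a : R) : wscale a +oo = +oo.
Proof. by rewrite /wscale eqxx. Qed.

Lemma wscale_neq_ninfty (a : R) x : x != -oo -> wscale a x != -oo.
Proof. by case: x => //= _; rewrite wscale_pinfty. Qed.

Lemma neq_ninftyP (x : \bar R) : x != -oo -> (exists r, x = r%:E) \/ x = +oo.
Proof. by case: x => [r _||//]; [left; exists r|right]. Qed.

(** A convexity inequality only has to be checked at finite values, since an
    infinite one makes the right-hand side [+oo]. *)
Lemma wscaleD_le (a b : R) x y z : x != -oo -> y != -oo ->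
  (forall r s, x = r%:E -> y = s%:E -> z <= (a * r + b * s)%:E) ->
  z <= wscale a x + wscale b y.
Proof.
move=> /neq_ninftyP[[r ->]|->] yN.
  have := yN => /neq_ninftyP[[s ->]|->] => [|_]; last first.
    by rewrite wscale_pinfty addey ?leey.
  by move=> /(_ r s erefl erefl).
by rewrite wscale_pinfty addye ?leey // wscale_neq_ninfty.
Qed.

(** Convexity of the epigraph, which avoids the convention [0 * +oo = +oo]. *)
Lemma econvexP {V : lmodType R} (g : V -> \bar R) :
  (forall v, g v != -oo) -> econvex g <->
  forall v w a b r s, (0 <= a)%R -> (0 <= b)%R -> (a + b = 1)%R ->
    g v <= r%:E -> g w <= s%:E -> g (a *: v + b *: w)%R <= (a * r + b * s)%:E.
Proof.
move=> gN; split=> [gc v w a b r s a0 b0 ab gr gs|gc v w a b a0 b0 ab].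
  apply: le_trans (gc v w a b a0 b0 ab) _.
  have [[r' gv]|gv] := neq_ninftyP (gN v); last by rewrite gv in gr.
  have [[s' gw]|gw] := neq_ninftyP (gN w); last by rewrite gw in gs.
  rewrite gv gw !wscale_fin lee_fin.
  by move: gr gs; rewrite gv gw !lee_fin => ? ?; rewrite lerD // ler_wpM2l.
apply: wscaleD_le => // r s gr gs.
by apply: gc => //; rewrite ?gr ?gs.
Qed.

End epigraph.

(** * Affine minorants of convex functions *)

Section sandwich.
Context {R : realType} {V : lmodType R}.

(** The concave function [z |-> - q (- z)] lies below the convex function [f];
    a linear [u] separates them. The functional
    [v |-> inf (t * f z + q (v - t *: z))] over [t >= 0] and [z] is the largest
    sublinear one below both [q] and [f]. Convexity of [f] makes it subadditive,
    the hypothesis makes it finite, and any linear functional below it will do. *)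
Theorem sandwich (q : V -> R) (f : V -> \bar R) (z0 : V) :
  sublinear q -> econvex f -> f z0 \is a fin_num ->
  (forall z, 0 <= f z + (q (- z))%:E)%E ->
  exists u : V -> R, [/\ linear (u : V -> R^o), forall v, u v <= q v &
    forall z, ((u z)%:E <= f z)%E].
Proof.
move=> sq fc fz0 fq.
have fN z : f z != -oo%E by have := fq z; case: (f z).
move: fc => /(econvexP fN) fc.
pose S v := [set c | exists t z r,
  [/\ 0 <= t, (f z <= r%:E)%E & c = t * r + q (v - t *: z)]].
have Slb v : lbound (S v) (- q (- v)).
  move=> _ [t [z [r [t0 fr ->]]]].
  have rz : 0 <= r + q (- z).
    by rewrite -lee_fin EFinD (le_trans (fq z)) // leeD2r.
  have := sublinear_lower (- (t *: z)) (- v) sq.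
  rewrite -scalerN sublinearZ // opprK [_ + v]addrC scalerN.
  by have := mulr_ge0 t0 rz; rewrite mulrDr; lra.
have Sq v : S v (q v).
  exists 0, z0, (fine (f z0)); rewrite fineK // mul0r scale0r subr0 add0r.
  by split.
have Sinf v : has_inf (S v).
  by split; [exists (q v)|exists (- q (- v))].
have sS : sublinear (fun v => inf (S v)).
  apply: inf_sublinear => // [v w a b|c v _ c0 [t [z [r [t0 fr ->]]]]]; last first.
    exists (c * t * r + q (c *: v - (c * t) *: z)).
      by exists (c * t), z, r; rewrite mulr_ge0.
    by rewrite -scalerA -scalerBr sublinearZ // mulrDr mulrA.
  move=> [t1 [z1 [r1 [t10 fr1 ->]]]] [t2 [z2 [r2 [t20 fr2 ->]]]] {a b}.
  have := sq.1 (v - t1 *: z1) (w - t2 *: z2); rewrite addrACA -opprD => qle.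
  (* The point z below is a weighted mean of z1 and z2, hence the case t1 = t2 = 0. *)
  have [t0|t0] := eqVneq (t1 + t2) 0.
    exists (q (v + w)) => //.
    have /eqP := t0; rewrite paddr_eq0 // => /andP[/eqP t1E /eqP t2E].
    by move: qle; rewrite t1E t2E !scale0r addr0 subr0 !mul0r !add0r !subr0.
  have t12 : 0 <= t1 + t2 by rewrite addr_ge0.
  pose z := (t1 / (t1 + t2)) *: z1 + (t2 / (t1 + t2)) *: z2.
  pose r := t1 / (t1 + t2) * r1 + t2 / (t1 + t2) * r2.
  have tz : (t1 + t2) *: z = t1 *: z1 + t2 *: z2.
    by rewrite scalerDr !scalerA !mulrA ![_ * t1]mulrC ![_ * t2]mulrC !mulfK.
  have tr : (t1 + t2) * r = t1 * r1 + t2 * r2 by rewrite /r; field.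
  exists ((t1 + t2) * r + q (v + w - (t1 + t2) *: z)).
    exists (t1 + t2), z, r; split=> //.
    by apply: fc => //; rewrite ?divr_ge0 // -mulrDl divff.
  by rewrite tr tz; lra.
have [u lu uS] := hahn_banach sS.
exists u; split=> // [v|z].
  by rewrite (le_trans (uS v)) //; apply: ge_inf => //; case: (Sinf v).
have [[r fr]|->] := neq_ninftyP (fN z); last by rewrite leey.
rewrite fr lee_fin (le_trans (uS z)) //.
apply: ge_inf; first by case: (Sinf z).
exists 1, z, r; rewrite fr lexx ler01 scale1r subrr (sublinear0 sq).
by split=> //; ring.
Qed.

End sandwich.

Section dual_facts.
Context {R : realType} {X : normedModType R}.

(** On the zero space the pointwise bound is void and [M] may be negative, hence
    the guard on the norm estimate. *)
Lemma bounded_dual (u : X -> R^o) (M : R) :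
  linear u -> (forall v, `|u v| <= M * `|v|) ->
  exists2 a : dual X, a = u :> (X -> R^o) & 0 <= M -> `|a| <= M.
Proof.
move=> lu uM.
have cu : continuous u.
  pose L := GRing.isLinear.Build R X R^o _ u lu.
  pose uL : {linear X -> R^o} := HB.pack u L.
  apply: (@linear_bounded_continuous R X R^o uL).1.
  apply/bounded_funP => r; exists (`|M| * r) => v vr.
  apply: le_trans (uM v) _; rewrite (le_trans (ler_norm _)) //.
  by rewrite normrM normr_id ler_wpM2l.
have up : u \in dual_pred X by apply/dual_predP.
exists (Dual up) => // M0; apply: dual_norm_le => v v1 /=.
by rewrite (le_trans (uM v)) // ler_piMr.
Qed.

(** Lower semicontinuity gives a ball around [x] on which [phi > r]. Convexity
    then bounds [phi] from below by [r - M * `|z|] at every [x + z], so that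
    [z |-> phi (x + z) - r] dominates [- M * `|z|] and the sandwich theorem
    applies with [q = M * `|.|]. The linear functional found this way is bounded
    by [q], hence continuous. *)
Theorem affine_minorant (phi : X -> \bar R) (x : X) (r : R) :
  (forall v, phi v != -oo%E) -> econvex phi -> lower_semicontinuous phi ->
  phi x \is a fin_num -> (r%:E < phi x)%E ->
  exists u : dual X, forall z, ((r + u (z - x)%R)%:E <= phi z)%E.
Proof.
move=> phiN phic philsc xfin rx.
have [s phix] : exists s, phi x = s%:E by exists (fine (phi x)); rewrite fineK.
have [U /nbhs_ballP[e /= e0 eU] Ur] := philsc x r rx.
have rs : r < s by rewrite -lte_fin -phix.
pose d := e / 2; have d0 : 0 < d by rewrite divr_gt0.
have near_r z : `|z| <= d -> (r%:E < phi (x + z)%R)%E.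
  move=> zd; apply/Ur/eU; rewrite -ball_normE /= opprD addNKr normrN.
  by rewrite (le_lt_trans zd) // /d; lra.
(* Along the segment from x to x + z, phi exceeds r up to distance d while
   starting at s, so its slope cannot be less than - (s - r) / d. *)
pose M := (s - r) / d.
have M0 : 0 <= M by rewrite divr_ge0 ?subr_ge0 // ltW.
pose q (v : X) := M * `|v|.
have sq : sublinear q.
  split=> [v w|c v c0]; first by rewrite /q -mulrDr ler_wpM2l // ler_normD.
  by rewrite /q normrZ ger0_norm // mulrCA.
have phic' := (econvexP phiN).1 phic.
pose f z := (phi (x + z)%R - r%:E)%E.
have fN z : f z != -oo%E.
  by have := phiN (x + z); rewrite /f; case: (phi (x + z)).
have fc : econvex f.
  apply/econvexP => // v w a b p1 p2 a0 b0 ab.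
  rewrite /f !leeBlDr // -!EFinD => fv fw.
  rewrite (_ : x + _ = a *: (x + v) + b *: (x + w)); last first.
    by rewrite !scalerDr addrACA -scalerDl ab scale1r.
  rewrite (le_trans (phic' _ _ _ _ _ _ a0 b0 ab fv fw)) // lee_fin.
  by rewrite !mulrDr addrACA -mulrDl ab mul1r.
have [u [lu uq uf]] : exists u : X -> R, [/\ linear (u : X -> R^o),
    forall v, u v <= q v & forall z, ((u z)%:E <= f z)%E].
  apply: (@sandwich _ _ q f 0) => // [|z]; first by rewrite /f addr0 phix.
  rewrite /f; have [[p pz]|->] := neq_ninftyP (phiN (x + z)); last first.
    by rewrite !addye // leey.
  rewrite pz -EFinB -EFinD lee_fin /q normrN.
  have [zd|dz] := leP `|z| d.
    have := near_r _ zd; rewrite pz lte_fin => rp.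
    by rewrite addr_ge0 ?subr_ge0 ?(ltW rp) // mulr_ge0.
  have z0 : 0 < `|z| by exact: lt_trans dz.
  pose t := d / `|z|.
  have t0 : 0 < t by rewrite divr_gt0.
  have t1 : t < 1 by rewrite ltr_pdivrMr // mul1r.
  have Mt : t * (M * `|z|) = s - r.
    by rewrite /t /M; field; rewrite !gt_eqF.
  have := near_r (t *: z); rewrite normrZ (gtr0_norm t0) divfK ?gt_eqF //.
  move=> /(_ (lexx _)).
  rewrite (_ : x + t *: z = (1 - t) *: x + t *: (x + z)); last first.
    by rewrite scalerDr addrA -scalerDl subrK scale1r.
  have t1' : 0 <= 1 - t by lra.
  have phixs : (phi x <= s%:E)%E by rewrite phix.
  have phizp : (phi (x + z)%R <= p%:E)%E by rewrite pz.
  move=> /lt_le_trans /(_ (phic' _ _ _ _ _ _ t1' (ltW t0) (subrK _ _) phixs phizp)).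
  rewrite lte_fin => rt.
  rewrite -(pmulr_rge0 _ t0) mulrDr Mt.
  have : 0 <= t * (s - r) by rewrite mulr_ge0 // ?subr_ge0 ltW.
  by nra.
have ule v : `|u v| <= M * `|v|.
  rewrite ler_norml uq andbT lerNl.
  have /= uN : - u v = u (- v).
    have := lu (-1) v 0; have := lu (-1) 0 0.
    by rewrite !scaleN1r !addr0 oppr0 /GRing.scale /=; lra.
  by rewrite uN -normrN uq.
have [a au _] := bounded_dual lu ule.
exists a => z; rewrite EFinD addeC -leeBrDr //.
by have := uf (z - x); rewrite /f subrKC au.
Qed.

End dual_facts.

(** * Weak-* compactness of the dual ball *)

Section weak_star.
Context {R : realType} {X : normedModType R}.

Lemma eval_continuous (v : X) :
  continuous (fun f : {ptws X -> R^o} => f v : R^o).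
Proof. exact: (@proj_continuous X (fun=> R^o) v). Qed.

(** The weak-* topology is the topology of pointwise convergence. For it, the
    ball consists of the linear elements of a product of segments, which is
    compact by Tychonoff's theorem, and linearity is a closed condition. *)
Theorem banach_alaoglu (eps : R) : 0 <= eps ->
  compact ((@dual_fun R X : dual X -> {ptws X -> R^o}) @` dual_cball eps).
Proof.
move=> eps0.
pose box : set {ptws X -> R^o} :=
  [set f | forall v, `[- (eps * `|v|), eps * `|v|]%classic (f v)].
pose lin : set {ptws X -> R^o} :=
  \bigcap_(p in [set: R * X * X])
    (fun f : {ptws X -> R^o} => f (p.1.1 *: p.1.2 + p.2) - p.1.1 *: f p.1.2
       - f p.2 : R^o) @^-1` [set 0].
have cbox : compact box.
  apply: (@tychonoff X (fun=> R^o)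
    (fun v => `[- (eps * `|v|), eps * `|v|]%classic)) => v.
  exact: segment_compact.
have clin : closed lin.
  apply: closed_bigI => -[[c v] w] _.
  pose g (f : {ptws X -> R^o}) : R^o := f (c *: v + w) - c *: f v - f w.
  apply: (@closed_comp _ _ g [set 0]); last exact: (@closed_eq R 0).
  move=> f _.
  have ev u : (f' u : R^o) @[f' --> (f : {ptws X -> R^o})] --> (f u : R^o).
    exact: eval_continuous.
  have FF : Filter (nbhs (f : {ptws X -> R^o})) by exact: nbhs_filter.
  have h1 : c *: (f' v : R^o) @[f' --> (f : {ptws X -> R^o})] -->
      c *: (f v : R^o) by exact: cvgZ (cvg_cst c) (ev v).
  have h2 := @cvgB _ R^o _ _ FF _ _ _ _ (ev (c *: v + w)) h1.
  exact (@cvgB _ R^o _ _ FF _ _ _ _ h2 (ev w)).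
rewrite [X in compact X](_ : _ = box `&` lin); first exact: compact_closedI.
apply/seteqP; split=> [_ [a aeps <-]|f [fbox flin]].
  split=> [v|[[c v] w] _] /=; last by rewrite linearP -addrA -opprD subrr.
  rewrite in_itv /= -ler_norml (le_trans (dual_norm_apply a v)) //.
  by rewrite ler_wpM2r.
have [|v|a af aeps] := @bounded_dual R X f eps.
- move=> c v w; apply/eqP; rewrite -subr_eq0 opprD addrA.
  by apply/eqP; exact: (flin ((c, v), w)).
- by have := fbox v; rewrite /= in_itv /= -ler_norml.
by exists a => //; exact: aeps.
Qed.

End weak_star.

(** * The conjugate and the function minimized by bA *)

Section conjugate_facts.
Context {R : realType} {X : normedModType R}.
Variables (phi : X -> \bar R) (phiN : forall v, phi v != -oo%E).
Local Open Scope ereal_scope.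

Lemma conjugate_ge (u : dual X) v p :
  phi v = p%:E -> (u v - p)%:E <= conjugate phi u.
Proof. by move=> vp; apply: ereal_sup_ubound; exists v; rewrite // vp. Qed.

(** A bound on the conjugate at [u] is the same as a continuous affine minorant
    with slope [u]. *)
Lemma conjugate_leP (u : dual X) (r : R) :
  conjugate phi u <= r%:E <-> forall v, (u v - r)%:E <= phi v.
Proof.
split=> [ur v|ur].
  have [[p vp]|->] := neq_ninftyP (phiN v); last by rewrite leey.
  have := le_trans (conjugate_ge u vp) ur.
  by rewrite vp !lee_fin; lra.
apply: ge_ereal_sup => _ [v _ <-]; have := ur v.
have [[p ->]|->] := neq_ninftyP (phiN v); last by rewrite leNye.
by rewrite -EFinB !lee_fin; lra.
Qed.

Lemma conjugate_gt (u : dual X) (r : R) : r%:E < conjugate phi u ->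
  exists v p, phi v = p%:E /\ (r < u v - p)%R.
Proof.
move=> /ereal_sup_gt[_ [v _ <-]].
have [[p vp]|->//] := neq_ninftyP (phiN v).
by rewrite vp lte_fin; exists v, p.
Qed.

Variable phidom : edom phi !=set0.

Lemma conjugate_neq_ninfty (u : dual X) : conjugate phi u != -oo.
Proof.
have [x0 phix0] := phidom.
have := conjugate_ge u (esym (fineK phix0)).
by case: (conjugate phi u).
Qed.

Lemma fenchel_young (u : dual X) x : (u x)%:E <= phi x + conjugate phi u.
Proof.
have [[p xp]|->] := neq_ninftyP (phiN x); last first.
  by rewrite addye ?leey ?conjugate_neq_ninfty.
by rewrite xp addeC -leeBlDr // conjugate_ge.
Qed.

Lemma subdiff_fenchel (u : dual X) x :
  subdiff phi x u <-> phi x + conjugate phi u = (u x)%:E.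
Proof.
split=> [[/fineK xp ux]|e].
  apply/eqP; rewrite eq_le fenchel_young andbT.
  rewrite -xp addeC -leeBrDr // -EFinB; apply/conjugate_leP => v.
  have := ux v; rewrite -xp leeBrDr // -EFinD linearB /=.
  by apply: le_trans; rewrite lee_fin; lra.
have [[p xp]|xp] := neq_ninftyP (phiN x); last first.
  by move: e; rewrite xp addye ?conjugate_neq_ninfty.
split=> [|w]; first by rewrite /edom /= xp.
have := fenchel_young u w; rewrite xp leeBrDr // linearB /=.
have [[q ->]|->] := neq_ninftyP (phiN w); last by rewrite leey.
move: e; rewrite xp; case: (conjugate phi u) => // c [uxE].
by rewrite -!EFinD !lee_fin -uxE; lra.
Qed.

Lemma econvex_conjugate : econvex (conjugate phi).
Proof.
apply/econvexP; first exact: conjugate_neq_ninfty.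
move=> u w a b r s a0 b0 ab /conjugate_leP ur /conjugate_leP ws.
apply/conjugate_leP => v; have := ur v; have := ws v.
have [[p ->]|->] := neq_ninftyP (phiN v); last by rewrite !leey.
rewrite !lee_fin dual_addE !dual_scaleE => h1 h2.
have pE : p = (a * p + b * p)%R by rewrite -mulrDl ab mul1r.
have := ler_wpM2l a0 h2; have := ler_wpM2l b0 h1.
by rewrite !mulrBr; lra.
Qed.

Lemma fA_ge_pairing a x (y : dual X) : (y x)%:E <= fA phi a x y.
Proof.
have -> : (y x)%:E = ((y - a)%R x)%:E + (a x)%:E.
  by rewrite -EFinD -[(y - a)%R x]/(y x - a x)%R subrK.
by rewrite leeD2r // fenchel_young.
Qed.

Lemma fA_eq_pairing a x (y : dual X) :
  fA phi a x y = (y x)%:E <-> subdiff phi x (y - a)%R.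
Proof.
rewrite /fA; split=> [|/subdiff_fenchel ->]; last first.
  by rewrite -EFinD -[(y - a)%R x]/(y x - a x)%R subrK.
move=> e; apply/subdiff_fenchel.
have -> : (y - a)%R x = (y x - a x)%R by [].
by rewrite EFinB -e addeK.
Qed.

Lemma fA_pinfty a x y : phi x = +oo -> fA phi a x y = +oo.
Proof. by move=> xp; rewrite /fA xp addye ?conjugate_neq_ninfty. Qed.

Lemma bA_le eps a x y : dual_cball eps a -> bA phi eps x y <= fA phi a x y.
Proof. by move=> ae; apply: ereal_inf_lbound; exists a. Qed.

Lemma bA_geP eps x y (r : \bar R) :
  r <= bA phi eps x y <-> forall a, dual_cball eps a -> r <= fA phi a x y.
Proof.
split=> [rb a ae|rf]; first exact: le_trans (bA_le _ _ ae).
by apply: le_ereal_inf_tmp => _ [a ae <-]; exact: rf.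
Qed.

Lemma bA_ge_pairing eps x (y : dual X) : (y x)%:E <= bA phi eps x y.
Proof. by apply/bA_geP => a _; exact: fA_ge_pairing. Qed.

Lemma fA_neq_ninfty a x (y : dual X) : fA phi a x y != -oo.
Proof. by have := fA_ge_pairing a x y; case: (fA phi a x y). Qed.

Lemma bA_neq_ninfty eps x (y : dual X) : bA phi eps x y != -oo.
Proof. by have := bA_ge_pairing eps x y; case: (bA phi eps x y). Qed.

Lemma bA_pinfty eps x y : phi x = +oo -> bA phi eps x y = +oo.
Proof.
move=> xp; apply/eqP; rewrite -leye_eq; apply/bA_geP => a _.
by rewrite fA_pinfty.
Qed.

(** A strict lower bound of [a |-> fA phi a x y] on the dual ball can be improved
    by a positive amount, uniformly near [y]. For each [a], some [v] with
    [phi v] finite witnesses the bound through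
    [(y - a) v - phi v <= conjugate phi (y - a)], and this witness survives small
    changes of [y] and of the bound in norm and of [a] in the weak-* topology.
    Compactness makes this uniform in [a]. Both the existence of minimizers
    ([y' = y]) and lower semicontinuity in [y] are read off from it. *)
Lemma fA_gt_stable eps x y (r : R) : (0 <= eps)%R -> phi x != +oo ->
  (forall a, dual_cball eps a -> r%:E < fA phi a x y) ->
  exists2 d : R, (0 < d)%R &
    forall y', (`|y - y'| < d)%R -> (r + d)%:E <= bA phi eps x y'.
Proof.
move=> eps0 xN rf.
have [[s xs]|xp] := neq_ninftyP (phiN x); last by rewrite xp in xN.
have /compact_near_coveringP nK := @banach_alaoglu R X eps eps0.
pose P (i : R * dual X) (f : {ptws X -> R^o}) := exists v p,
  phi v = p%:E /\ (0 < s + (i.2 v - f v - p) + f x - i.1)%R.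
have nearP : \forall i \near ((r, y) : R * dual X),
    (@dual_fun R X : dual X -> {ptws X -> R^o}) @` dual_cball eps `<=` P i.
  have nF : Filter (nbhs ((r, y) : R * dual X)) by exact: nbhs_filter.
  apply: (nK _ _ P nF) => _ [a ae <-].
  have ra : (r - s - a x)%:E < conjugate phi (y - a)%R.
    have := rf a ae; rewrite /fA xs.
    case: (conjugate phi (y - a)%R) => [c|_|//]; last exact: ltry.
    by rewrite -!EFinD !lte_fin; lra.
  have [v [p [vp rvp]]] := conjugate_gt ra.
  pose g (j : {ptws X -> R^o} * (R * dual X)) : R :=
    (s + (j.2.2 v - j.1 v - p) + j.1 x - j.2.1)%R.
  pose F := filter_prod (nbhs (dual_fun a : {ptws X -> R^o}))
    (nbhs ((r, y) : R * dual X)).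
  have FF : Filter F by exact: filter_prod_filter.
  have ev w : (j.1 w : R) @[j --> F] --> (a w : R).
    apply: (@cvg_comp _ _ _ fst (fun f : {ptws X -> R^o} => f w : R^o) F
      (nbhs (dual_fun a : {ptws X -> R^o}))); first exact: cvg_fst.
    exact: (@eval_continuous R X w (dual_fun a)).
  have ei : j.2 @[j --> F] --> ((r, y) : R * dual X) by exact: cvg_snd.
  have ey : ((j : {ptws X -> R^o} * (R * dual X)).2.2 v : R) @[j --> F] --> (y v : R).
    apply: (@cvg_comp _ _ _ (fun j : {ptws X -> R^o} * (R * dual X) => j.2.2)
      (bidual v) F (nbhs y)).
      apply: (@cvg_comp _ _ _ snd snd F _ _ ei); exact: cvg_snd.
    exact: (@dual_continuous _ _ (bidual v)).
  have er : (j.2.1 : R) @[j --> F] --> (r : R).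
    apply: (@cvg_comp _ _ _ snd fst F _ _ ei); exact: cvg_fst.
  have gF : g @ F --> (s + (y v - a v - p) + a x - r)%R.
    have c1 := @cvgB _ R^o _ _ FF _ _ _ _
      (@cvgB _ R^o _ _ FF _ _ _ _ ey (ev v)) (@cvg_cst _ p _ F FF).
    have c2 := @cvgD _ R^o _ _ FF _ _ _ _
      (@cvgD _ R^o _ _ FF _ _ _ _ (@cvg_cst _ s _ F FF) c1) (ev x).
    exact (@cvgB _ R^o _ _ FF _ _ _ _ c2 er).
  have g0 : (0 < s + (y v - a v - p) + a x - r)%R.
    by move: rvp; rewrite -[(y - a)%R v]/(y v - a v)%R; lra.
  have gpos : \forall j \near F, (0 < g j)%R by exact: (@cvgr_gt R _ F FF _ _ gF _ g0).
  apply: (@filterS _ F FF) gpos => -[f i] /=.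
  by rewrite /g /= => gi; exists v, p.
have [d /= d0 dP] := (nbhs_ballP _ _).1 nearP.
exists (d / 2)%R => [|y' yy']; first by rewrite divr_gt0.
apply/bA_geP => a ae.
have [||v [p [vp gp]]] := dP ((r + d / 2)%R, y') _ a.
- split=> /=; rewrite -ball_normE /=; last by apply: lt_trans yy' _; lra.
  by rewrite opprD addNKr normrN gtr0_norm; lra.
- by exists a.
have := conjugate_ge (y' - a)%R vp; rewrite /= in gp.
rewrite /fA xs; case: (conjugate phi (y' - a)%R) => [c|_|//]; last first.
  exact: leey.
rewrite -!EFinD !lee_fin -[(y' - a)%R v]/(y' v - a v)%R.
by lra.
Qed.

(** If no [a] attained the infimum [m], then [m] would be a strict lower bound
    and could be improved. *)
Lemma bA_attained eps x y : (0 <= eps)%R ->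
  exists2 a, dual_cball eps a & bA phi eps x y = fA phi a x y.
Proof.
move=> eps0.
have ball0 : dual_cball eps (0%R : dual X) by rewrite /dual_cball /= normr0.
have [[m bm]|bp] := neq_ninftyP (bA_neq_ninfty eps x y); last first.
  exists 0%R => //; apply/eqP.
  by rewrite bp eq_sym -leye_eq -bp; exact: bA_le.
apply: contrapT => nex.
have mf a : dual_cball eps a -> m%:E < fA phi a x y.
  move=> ae; rewrite lt_neqAle -bm bA_le // andbT.
  by apply/eqP => e; apply: nex; exists a.
have xN : phi x != +oo.
  by apply/eqP => xp; have := bA_pinfty eps y xp; rewrite bm.
have [d d0 dm] := fA_gt_stable eps0 xN mf.
have := dm y; rewrite subrr normr0 => /(_ d0); rewrite bm lee_fin; lra.
Qed.

(** * Convexity and semicontinuity of bA in each variable *)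

Lemma bA_lsc_r eps x : (0 <= eps)%R -> lower_semicontinuous (bA phi eps x).
Proof.
move=> eps0 y r rb; have [xp|xN] := eqVneq (phi x) +oo.
  by exists setT => [|y' _]; [exact: filterT|rewrite bA_pinfty // ltry].
have [|d d0 dm] := fA_gt_stable eps0 xN (_ : forall a, _ -> r%:E < fA phi a x y).
  by move=> a ae; apply: lt_le_trans rb _; exact: bA_le.
exists (ball y d) => [|y']; first exact: nbhsx_ballx.
rewrite -ball_normE /= => /dm; apply: lt_le_trans.
by rewrite lte_fin; lra.
Qed.

(** At a fixed [x], the function is convex jointly in [a] and [y], because it
    depends on them through [y - a] and linearly through [a]; partial
    minimization over the convex ball keeps convexity in [y]. *)
Lemma fA_convex_dual x (u w u' w' : dual X) (a b : R) :
  (0 <= a)%R -> (0 <= b)%R -> (a + b = 1)%R ->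
  fA phi (a *: u' + b *: w')%R x (a *: u + b *: w)%R <=
  wscale a (fA phi u' x u) + wscale b (fA phi w' x w).
Proof.
move=> a0 b0 ab.
apply: wscaleD_le => [||r s]; [exact: fA_neq_ninfty|exact: fA_neq_ninfty|].
have := (econvexP conjugate_neq_ninfty).1 econvex_conjugate
  (u - u')%R (w - w')%R a b _ _ a0 b0 ab.
have <- : (a *: u + b *: w - (a *: u' + b *: w'))%R =
    (a *: (u - u') + b *: (w - w'))%R.
  by rewrite !scalerBr opprD addrACA.
rewrite /fA dual_addE !dual_scaleE.
have [[p ->]|->] := neq_ninftyP (phiN x); last first.
  by rewrite addye ?conjugate_neq_ninfty.
have [[c1 ->]|->] := neq_ninftyP (conjugate_neq_ninfty (u - u')%R) => //.
have [[c2 ->]|->] := neq_ninftyP (conjugate_neq_ninfty (w - w')%R) => //.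
move=> /(_ c1 c2 (lexx _) (lexx _)) h [<-] [<-].
have -> : (a * (p + c1 + u' x) + b * (p + c2 + w' x))%R =
    (p + (a * c1 + b * c2) + (a * u' x + b * w' x))%R.
  by rewrite -{3}[p]mul1r -ab; ring.
by rewrite !EFinD leeD2r // leeD2l // -EFinD.
Qed.

Lemma econvex_bA_r eps x : (0 <= eps)%R -> econvex (bA phi eps x).
Proof.
move=> eps0 u w a b a0 b0 ab.
have [u' u'e ->] := bA_attained x u eps0.
have [w' w'e ->] := bA_attained x w eps0.
apply: le_trans (fA_convex_dual _ _ _ _ _ a0 b0 ab).
apply: bA_le; rewrite /dual_cball /= (le_trans (ler_normD _ _)) //.
rewrite !normrZ !ger0_norm //.
have -> : eps = (a * eps + b * eps)%R by rewrite -mulrDl ab mul1r.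
by rewrite lerD // ler_wpM2l.
Qed.

Lemma lt_real_between (r : R) (e : \bar R) : r%:E < e ->
  exists2 q : R, (r < q)%R & q%:E < e.
Proof.
case: e => [s||//]; last by exists (r + 1)%R; rewrite ?ltry // ltrDl.
by rewrite lte_fin => rs; exists ((r + s) / 2)%R; rewrite ?lte_fin; lra.
Qed.

(** The map [x |-> inf_a (conjugate phi (y - a) + a x)] is [eps]-Lipschitz where
    it is finite. The proof uses only a lower bound [c] for it at [x], chosen
    so that [phi x + c > r], since when [phi x] is finite the infimum itself may
    be [+oo]. *)
Lemma bA_lsc_l eps y : (0 < eps)%R -> lower_semicontinuous phi ->
  lower_semicontinuous (fun x => bA phi eps x y).
Proof.
move=> eps0 philsc x r rb.
have [c [cle rc]] : exists c : R, (forall a, dual_cball eps a ->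
    c%:E <= conjugate phi (y - a)%R + (a x)%:E) /\ (r - c)%:E < phi x.
  have [[s xs]|xp] := neq_ninftyP (phiN x).
    have [r1 rr1 r1b] := lt_real_between rb.
    exists (r1 - s)%R; split=> [a ae|]; last by rewrite xs lte_fin; lra.
    have := le_trans (ltW r1b) (bA_le x y ae); rewrite /fA xs.
    case: (conjugate phi (y - a)%R) => [t|_|//]; last exact: leey.
    by rewrite -!EFinD !lee_fin; lra.
  have [x0 phix0] := phidom.
  (* Here phi x is +oo, so any lower bound will do: evaluate the conjugate at a
     point x0 of the domain. *)
  exists (y x0 - fine (phi x0) - eps * `|x - x0|)%R.
  split=> [a ae|]; last by rewrite xp ltry.
  have := conjugate_ge (y - a)%R (esym (fineK phix0)).
  case: (conjugate phi (y - a)%R) => [t|_|//]; last exact: leey.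
  rewrite -!EFinD !lee_fin -[(y - a)%R x0]/(y x0 - a x0)%R.
  have := le_trans (ler_norm _) (dual_norm_apply a (x0 - x)%R).
  rewrite distrC linearB /=.
  have : (`|a| * `|x - x0| <= eps * `|x - x0|)%R by rewrite ler_wpM2r.
  rewrite -[dual_norm a]/(`|a|%R ).
  by lra.
have [q rq qx] := lt_real_between rc.
have [U xU Uq] := philsc x q qx.
pose d := ((q - (r - c)) / 2 / eps)%R.
have d0 : (0 < d)%R by rewrite !divr_gt0 //; lra.
have dE : (eps * d = (q - (r - c)) / 2)%R by rewrite /d; field; rewrite gt_eqF.
exists (U `&` ball x d) => [|z [Uz]].
  by apply: filterI => //; exact: nbhsx_ballx.
rewrite -ball_normE /= => xz.
apply: (@lt_le_trans _ _ (r + (q - (r - c)) / 2)%:E); first by rewrite lte_fin; lra.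
apply/bA_geP => a ae.
have := Uq z Uz; have := cle a ae; rewrite /fA.
case: (conjugate phi (y - a)%R) => [t||//]; last first.
  by have := phiN z; case: (phi z) => // *; exact: leey.
have := phiN z; case: (phi z) => [p|_ _ _|//]; last exact: leey.
move=> _.
rewrite -!EFinD !lee_fin lte_fin.
have := le_trans (ler_norm _) (dual_norm_apply a (x - z)%R).
have : (`|a| * `|x - z| <= eps * d)%R by rewrite ler_pM // ltW.
rewrite dE linearB /= -[dual_norm a]/(`|a|%R ).
by lra.
Qed.

End conjugate_facts.

(** * Subgradients, graph and convexity of bA *)

Section subdifferentials.
Context {R : realType} {X : normedModType R}.
Variables (phi : X -> \bar R) (eps : R).
Hypotheses (phiG : Gamma0 X phi) (eps0 : 0 < eps).
Local Open Scope ereal_scope.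

(** Keep the minimizer [a] for [(x, y)] fixed and let [z] vary:
    [fA phi a z y - y z = conjugate phi (y - a) - ((y - a) z - phi z)], which
    comes arbitrarily close to 0. The subgradient inequality carries this bound
    from [z] back to [x]. *)
Lemma bA_subdiff_l x (y : dual X) :
  subdiff (fun z => bA phi eps z y) x y -> bA phi eps x y = (y x)%:E.
Proof.
case: phiG => phiN _ _ phidom.
case=> [/fineK xm ym]; apply/eqP; rewrite eq_le bA_ge_pairing // andbT.
have [a ae ba] := bA_attained phiN phidom x y (ltW eps0).
apply/lee_addgt0Pr => e e0.
have [c cE] : exists c, conjugate phi (y - a)%R = c%:E.
  have := fA_neq_ninfty phiN phidom a x y.
  move: xm; rewrite ba /fA.
  have [[c ->]|->] := neq_ninftyP (conjugate_neq_ninfty phidom (y - a)%R).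
    by exists c.
  by rewrite addey // addye.
have [z [p [zp cz]]] : exists z p, phi z = p%:E /\ (c - e < (y - a)%R z - p)%R.
  by apply: conjugate_gt => //; rewrite cE lte_fin; lra.
have := ym z; rewrite -xm leeBrDr // -EFinD => h.
have := le_trans h (bA_le phi z y ae).
rewrite /fA zp cE -!EFinD !lee_fin linearB /=.
by move: cz; rewrite -[(y - a)%R z]/(y z - a z)%R; lra.
Qed.

(** Test the subgradient inequality at the slope [u] of an affine minorant of
    [phi] that is [e]-close to [phi] at [x], with [a = 0]. *)
Lemma bA_subdiff_r x (y : dual X) :
  subdiff (bA phi eps x) y (bidual x) -> bA phi eps x y = (y x)%:E.
Proof.
case: phiG => phiN phic philsc phidom.
case=> [/fineK ym xm]; apply/eqP; rewrite eq_le bA_ge_pairing // andbT.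
have [[s xs]|xp] := neq_ninftyP (phiN x); last first.
  by move: ym; rewrite bA_pinfty.
apply/lee_addgt0Pr => e e0.
have [||u um] := @affine_minorant _ _ phi x (s - e) phiN phic philsc.
- by rewrite xs.
- by rewrite xs lte_fin; lra.
have cu : conjugate phi u <= (u x - (s - e))%:E.
  apply/conjugate_leP => // v; apply: le_trans (um v).
  by rewrite lee_fin linearB /=; lra.
have ball0 : dual_cball eps (0%R : dual X) by rewrite /dual_cball /= normr0 ltW.
have := xm u; rewrite -ym leeBrDr // -EFinD => h.
have := le_trans h (bA_le phi x u ball0).
rewrite /fA xs subr0; move: cu; case: (conjugate phi u) => [c|//|_].
  rewrite -!EFinD !lee_fin -[bidual x (u - y)%R]/(u x - y x)%R.
  by rewrite -[(0%R : dual X) x]/(0%R : R); lra.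
by rewrite -EFinD leeNy_eq.
Qed.

(** Since [bA] dominates the pairing everywhere, at a point of equality the
    pairing itself is a subgradient in each variable. *)
Lemma subdiff_of_pairing x (y : dual X) : bA phi eps x y = (y x)%:E ->
  subdiff (fun z => bA phi eps z y) x y /\
  subdiff (bA phi eps x) y (bidual x).
Proof.
case: phiG => phiN _ _ phidom e.
split; (split=> [|w]; first by rewrite /edom /= e); rewrite e leeBrDr // -EFinD.
  by rewrite linearB subrK bA_ge_pairing.
by rewrite -[bidual x (w - y)%R]/(w x - y x)%R subrK bA_ge_pairing.
Qed.

Lemma bgraph_bA : bgraph (bA phi eps) = Mset phi eps.
Proof.
case: phiG => phiN _ _ phidom.
apply/seteqP; split=> -[x y] /=.
  move=> e; have [a ae ba] := bA_attained phiN phidom x y (ltW eps0).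
  exists (- a)%R; first by rewrite /dual_cball /= normrN.
  by apply/(fA_eq_pairing phiN phidom); rewrite -ba.
move=> [a ae /=]; rewrite -[in (y + a)%R](opprK a).
move=> /(fA_eq_pairing phiN phidom) fxy.
apply/eqP; rewrite eq_le bA_ge_pairing // andbT -fxy; apply: bA_le.
by rewrite /dual_cball /= normrN.
Qed.

Lemma econvex_bA_l y :
  econvex (fun x => bA phi eps x y) <->
  implicitly_convex (dual_cball eps) (fun a x => fA phi a x y).
Proof.
case: phiG => phiN _ _ phidom; split=> [bc|[_ fc] v w a b a0 b0 ab].
  split=> [a v _|a1 a2 v w a b a1e a2e /andP[a0 _] /andP[b0 _] ab].
    exact: fA_neq_ninfty.
  have [a' a'e ba'] := bA_attained phiN phidom (a *: v + b *: w)%R y (ltW eps0).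
  exists a' => //; rewrite -ba'.
  have := bA_le phi w y a2e; have := bA_le phi v y a1e => b1 b2.
  apply: wscaleD_le => [||r s fr fs]; [exact: fA_neq_ninfty..|].
  have bN x := bA_neq_ninfty phiN phidom eps x y.
  by apply: (econvexP bN).1 => //; rewrite -?fr -?fs.
have [a1 a1e ->] := bA_attained phiN phidom v y (ltW eps0).
have [a2 a2e ->] := bA_attained phiN phidom w y (ltW eps0).
have [|||l le lf] := fc a1 a2 v w a b a1e a2e.
- by rewrite a0 -ab lerDl.
- by rewrite b0 -ab lerDr.
- exact: ab.
by apply: le_trans lf; exact: bA_le.
Qed.

End subdifferentials.

Theorem theorem6p2 (R : realType) (X : completeNormedModType R)
  (Xrefl : reflexive_space X) (phi : X -> \bar R) (phiG : Gamma0 X phi)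
  (eps : R) (eps0 : 0 < eps) :
  (bipotential (bA phi eps) /\ bgraph (bA phi eps) = Mset phi eps) <->
  (forall y : dual X,
     implicitly_convex (dual_cball eps)
       (fun (a : dual X) (x : X) => fA phi a x y)).
Proof.
have [phiN _ philsc phidom] := phiG.
split=> [[[_ [_ bG] _ _] _] y|fc].
  apply/econvex_bA_l => //.
  have [dom0|/set0P/bG[]//] := eqVneq (edom (fun x => bA phi eps x y)) set0.
  have binf x : bA phi eps x y = +oo%E.
    have [[r br]|//] := neq_ninftyP (bA_neq_ninfty phiN phidom eps x y).
    have : edom (fun x => bA phi eps x y) x by rewrite /edom /= br.
    by rewrite dom0.
  by move=> v w a b _ _ _; rewrite !binf !wscale_pinfty.
split; last exact: bgraph_bA.
split.
- by move=> x y; exact: bA_neq_ninfty.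
- split=> [x|y] dom; split=> //.
  + by move=> y; exact: bA_neq_ninfty.
  + exact: econvex_bA_r (ltW eps0).
  + exact: bA_lsc_r (ltW eps0).
  + by move=> x; exact: bA_neq_ninfty.
  + exact/econvex_bA_l.
  + exact: bA_lsc_l.
- by move=> x y; exact: bA_ge_pairing.
- move=> x y; split; split.
  + by move=> /(bA_subdiff_l phiG eps0)/(subdiff_of_pairing phiG)[].
  + by move=> /(bA_subdiff_r phiG eps0)/(subdiff_of_pairing phiG)[].
  + exact: bA_subdiff_r.
  + by move=> /(subdiff_of_pairing phiG)[].
Qed.
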